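(* Let $\mathcal{C}$ be a category with pullbacks and $\mathbb{T}=(T,\eta,\mu)$ a monad on $\mathcal{C}$ (the functor $T$ is not assumed to preserve pullbacks). The category $\mathsf{Cat}(\mathbb{T})$ has pullbacks, and the class of perfect $\mathbb{T}$-functors is stable under them.
   Context: Composition is written $g\cdot f$ ($f$ first). A $\mathbb{T}$-graph $A=(A_0,A_1,d_0,c_0)$ is a pair of morphisms $d_0:A_1\to TA_0$, $c_0:A_1\to A_0$ in $\mathcal{C}$. A morphism $f=(f_0,f_1):A\to B$ of $\mathbb{T}$-graphs consists of $f_0:A_0\to B_0$, $f_1:A_1\to B_1$ with $d_0^B\cdot f_1=Tf_0\cdot d_0^A$ and $c_0^B\cdot f_1=f_0\cdot c_0^A$. A pointed $\mathbb{T}$-graph $(A,i)$ is a $\mathbb{T}$-graph $A$ with a morphism $i:A_0\to A_1$ such that $d_0\cdot i=\eta_{A_0}$ and $c_0\cdot i=1_{A_0}$. Morphisms of pointed $\mathbb{T}$-graphs are $\mathbb{T}$-graph morphisms $f$ with $f_1\cdot i^A=i^B\cdot f_0$. For a pointed $\mathbb{T}$-graph $(A,i)$, let $A_2$ be the pullback of $Tc_0:TA_1\to TA_0$ and $d_0:A_1\to TA_0$, with projections $d_1:A_2\to TA_1$, $c_1:A_2\to A_1$ (so $Tc_0\cdot d_1=d_0\cdot c_1$), and let $A_3$ be the pullback of $Tc_1:TA_2\to TA_1$ and $d_1:A_2\to TA_1$, with projections $d_2:A_3\to TA_2$, $c_2:A_3\to A_2$ (so $Tc_1\cdot d_2=d_1\cdot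 c_2$). Morphisms $i_1,i_2:A_1\to A_2$ are determined by $d_1\cdot i_1=Ti\cdot d_0$, $c_1\cdot i_1=1_{A_1}$, $d_1\cdot i_2=\eta_{A_1}$, $c_1\cdot i_2=i\cdot c_0$. A $\mathbb{T}$-category $(A,i,m)$ is a pointed $\mathbb{T}$-graph $(A,i)$ with a morphism $m:A_2\to A_1$ such that $d_0\cdot m=\mu_{A_0}\cdot Td_0\cdot d_1$, $c_0\cdot m=c_0\cdot c_1$, $m\cdot i_1=1_{A_1}=m\cdot i_2$, and $m\cdot m_1=m\cdot m_2$, where $m_1,m_2:A_3\to A_2$ are determined by $d_1\cdot m_1=Tm\cdot d_2$, $c_1\cdot m_1=c_1\cdot c_2$, $d_1\cdot m_2=\mu_{A_1}\cdot Td_1\cdot d_2$, $c_1\cdot m_2=m\cdot c_2$. A $\mathbb{T}$-functor $f:A\to B$ is a morphism of pointed $\mathbb{T}$-graphs with $f_1\cdot m^A=m^B\cdot f_2$, where $f_2:A_2\to B_2$ is determined by $d_1^B\cdot f_2=Tf_1\cdot d_1^A$, $c_1^B\cdot f_2=f_1\cdot c_1^A$. $\mathbb{T}$-categories and $\mathbb{T}$-functors form $\mathsf{Cat}(\mathbb{T})$. A $\mathbb{T}$-functor $f:A\to B$ is perfect (a discrete cofibration) if the square $d_0^B\cdot f_1=Tf_0\cdot d_0^A$ is a pullback diagram in $\mathcal{C}$, i.e. exhibits $A_1$ as the pullback of $Tf_0:TA_0\to TB_0$ and $d_0^B:B_1\to TB_0$, with projections $d_0^A$ and $f_1$. *)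

(* Defs.v *)
From Corelib Require Import ssreflect.
From Stdlib Require Import Classical ClassicalEpsilon.

Set Implicit Arguments.
Unset Strict Implicit.
Unset Printing Implicit Defensive.

Declare Scope cat_scope.
Delimit Scope cat_scope with cat.
Local Open Scope cat_scope.

Record Category := {
  ob :> Type;
  hom : ob -> ob -> Type;
  idm : forall a, hom a a;
  comp : forall a b c, hom b c -> hom a b -> hom a c;
  comp1m : forall a b (f : hom a b), comp (idm b) f = f;
  compm1 : forall a b (f : hom a b), comp f (idm a) = f;
  compA : forall a b c d (h : hom c d) (g : hom b c) (f : hom a b),
    comp h (comp g f) = comp (comp h g) f }.

Arguments hom {_} a b.
Arguments idm {_} a.
Arguments comp {_ a b c} g f : rename.

Notation "g · f" := (comp g f) (at level 40, left associativity) : cat_scope.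

Record Functor (C D : Category) := {
  fob :> C -> D;
  fmap : forall a b : C, hom a b -> hom (fob a) (fob b);
  fmap1 : forall a, fmap (idm a) = idm (fob a);
  fmapM : forall a b c (g : hom b c) (f : hom a b),
    fmap (g · f) = fmap g · fmap f }.

Arguments fmap {C D} F {a b} f : rename.

Record Monad (C : Category) := {
  mfun :> Functor C C;
  eta : forall a : C, hom a (mfun a);
  mu : forall a : C, hom (mfun (mfun a)) (mfun a);
  eta_nat : forall (a b : C) (f : hom a b),
    fmap mfun f · eta a = eta b · f;
  mu_nat : forall (a b : C) (f : hom a b),
    fmap mfun f · mu a = mu b · fmap mfun (fmap mfun f);
  mu_etal : forall a, mu a · eta (mfun a) = idm (mfun a);
  mu_etar : forall a, mu a · fmap mfun (eta a) = idm (mfun a);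
  mu_assoc : forall a, mu a · mu (mfun a) = mu a · fmap mfun (mu a) }.

Arguments eta {C} T a : rename.
Arguments mu {C} T a : rename.

Definition is_pullback (C : Category) (a b c p : C)
    (f : hom a c) (g : hom b c) (p1 : hom p a) (p2 : hom p b) : Prop :=
  f · p1 = g · p2 /\
  forall (x : C) (u : hom x a) (v : hom x b), f · u = g · v ->
    exists! h : hom x p, p1 · h = u /\ p2 · h = v.

Definition has_pullbacks (C : Category) : Prop :=
  forall (a b c : C) (f : hom a c) (g : hom b c),
    exists (p : C) (p1 : hom p a) (p2 : hom p b), is_pullback f g p1 p2.

(** Phrases such as "the pullback of f and g" refer to a choice of pullbacks;
    by [has_pullbacksP] below one exists exactly when the category has
    pullbacks. *)
Record pullback_choice (C : Category) := {
  pb : forall (a b c : C), hom a c -> hom b c -> C;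
  pb1 : forall (a b c : C) (f : hom a c) (g : hom b c), hom (pb f g) a;
  pb2 : forall (a b c : C) (f : hom a c) (g : hom b c), hom (pb f g) b;
  pbP : forall (a b c : C) (f : hom a c) (g : hom b c),
    is_pullback f g (pb1 f g) (pb2 f g) }.

Arguments pb {C} P {a b c} f g : rename.
Arguments pb1 {C} P {a b c} f g : rename.
Arguments pb2 {C} P {a b c} f g : rename.
Arguments pbP {C} P {a b c} f g : rename.

Lemma has_pullbacksP (C : Category) :
  has_pullbacks C <-> inhabited (pullback_choice C).
Proof.
split=> [H|[P] a b c f g]; last first.
  by exists (pb P f g), (pb1 P f g), (pb2 P f g); apply: pbP.
pose S a b c (f : hom a c) (g : hom b c) :=
  constructive_indefinite_description _ (H a b c f g).
pose S1 a b c f g := constructive_indefinite_description _ (proj2_sig (S a b c f g)).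
pose S2 a b c f g := constructive_indefinite_description _ (proj2_sig (S1 a b c f g)).
by constructor; exists (fun a b c f g => proj1_sig (S a b c f g))
  (fun a b c f g => proj1_sig (S1 a b c f g))
  (fun a b c f g => proj1_sig (S2 a b c f g)) => a b c f g; case: (S2 a b c f g).
Qed.

Section Pairing.
Variables (C : Category) (P : pullback_choice C).
Variables (a b c : C) (f : hom a c) (g : hom b c).

Lemma pb_comm : f · pb1 P f g = g · pb2 P f g.
Proof. exact: (proj1 (pbP P f g)). Qed.

Definition pb_pair (x : C) (u : hom x a) (v : hom x b) (e : f · u = g · v) :
    hom x (pb P f g) :=
  proj1_sig (constructive_definite_description _ (proj2 (pbP P f g) x u v e)).

Lemma pb1_pair x u v e : pb1 P f g · @pb_pair x u v e = u.
Proof.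
exact: (proj1 (proj2_sig
  (constructive_definite_description _ (proj2 (pbP P f g) x u v e)))).
Qed.

Lemma pb2_pair x u v e : pb2 P f g · @pb_pair x u v e = v.
Proof.
exact: (proj2 (proj2_sig
  (constructive_definite_description _ (proj2 (pbP P f g) x u v e)))).
Qed.

Lemma pb_ext x (h k : hom x (pb P f g)) :
  pb1 P f g · h = pb1 P f g · k -> pb2 P f g · h = pb2 P f g · k -> h = k.
Proof.
move=> e1 e2.
have e : f · (pb1 P f g · k) = g · (pb2 P f g · k) by rewrite !compA pb_comm.
case: (proj2 (pbP P f g) _ _ _ e) => l [_ U].
by rewrite -(U h) ?(U k).
Qed.
End Pairing.

Arguments pb_pair {C} P {a b c f g x} u v e.

(** A class of morphisms [W] is stable under pullback when, in every pullback
    square of the category, the projection opposite to a member of [W] is in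
    [W]. *)
Definition pullback_stable (C : Category)
    (W : forall a b : C, hom a b -> Prop) : Prop :=
  forall (a b c p : C) (f : hom a c) (g : hom b c)
    (p1 : hom p a) (p2 : hom p b),
    is_pullback f g p1 p2 -> W a c f -> W p b p2.

Section TCategories.
Variables (C : Category) (P : pullback_choice C) (T : Monad C).

(** For a T-graph [A]: [gd1], [gc1] are the projections d_1, c_1 of
    A_2 = [g2], and [gd2], [gc2] the projections d_2, c_2 of A_3 = [g3]. *)
Record TGraph := {
  g0 : C;
  g1 : C;
  gd0 : hom g1 (T g0);
  gc0 : hom g1 g0 }.

Record TGraphMor (A B : TGraph) := {
  f0 : hom (g0 A) (g0 B);
  f1 : hom (g1 A) (g1 B);
  f_d0 : gd0 B · f1 = fmap T f0 · gd0 A;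
  f_c0 : gc0 B · f1 = f0 · gc0 A }.

Record PTGraph := {
  pt_graph :> TGraph;
  pt_i : hom (g0 pt_graph) (g1 pt_graph);
  pt_d0i : gd0 pt_graph · pt_i = eta T (g0 pt_graph);
  pt_c0i : gc0 pt_graph · pt_i = idm (g0 pt_graph) }.

Record PTGraphMor (A B : PTGraph) := {
  ptm_mor :> TGraphMor A B;
  ptm_i : f1 ptm_mor · pt_i A = pt_i B · f0 ptm_mor }.

Section Nerve.
Variable A : PTGraph.

Definition g2 : C := pb P (fmap T (gc0 A)) (gd0 A).
Definition gd1 : hom g2 (T (g1 A)) := pb1 P (fmap T (gc0 A)) (gd0 A).
Definition gc1 : hom g2 (g1 A) := pb2 P (fmap T (gc0 A)) (gd0 A).

Definition g3 : C := pb P (fmap T gc1) gd1.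
Definition gd2 : hom g3 (T g2) := pb1 P (fmap T gc1) gd1.
Definition gc2 : hom g3 g2 := pb2 P (fmap T gc1) gd1.

Lemma g2_comm : fmap T (gc0 A) · gd1 = gd0 A · gc1.
Proof. exact: pb_comm. Qed.

Lemma g3_comm : fmap T gc1 · gd2 = gd1 · gc2.
Proof. exact: pb_comm. Qed.

Lemma i1_compat :
  fmap T (gc0 A) · (fmap T (pt_i A) · gd0 A) = gd0 A · idm (g1 A).
Proof. by rewrite compA -fmapM pt_c0i fmap1 comp1m compm1. Qed.

Lemma i2_compat : fmap T (gc0 A) · eta T (g1 A) = gd0 A · (pt_i A · gc0 A).
Proof. by rewrite eta_nat compA pt_d0i. Qed.

Definition i1 : hom (g1 A) g2 :=
  pb_pair P (fmap T (pt_i A) · gd0 A) (idm (g1 A)) i1_compat.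
Definition i2 : hom (g1 A) g2 :=
  pb_pair P (eta T (g1 A)) (pt_i A · gc0 A) i2_compat.

Variable m : hom g2 (g1 A).
Hypothesis m_d0 : gd0 A · m = mu T (g0 A) · fmap T (gd0 A) · gd1.
Hypothesis m_c0 : gc0 A · m = gc0 A · gc1.

Lemma m1_compat : fmap T (gc0 A) · (fmap T m · gd2) = gd0 A · (gc1 · gc2).
Proof.
by rewrite compA -fmapM m_c0 fmapM -compA g3_comm !compA g2_comm.
Qed.

Lemma m2_compat :
  fmap T (gc0 A) · (mu T (g1 A) · fmap T gd1 · gd2) = gd0 A · (m · gc2).
Proof.
rewrite [RHS]compA m_d0 -!compA -g3_comm !compA mu_nat.
by rewrite -!(compA (mu T (g0 A))) -!fmapM g2_comm.
Qed.

Definition m1 : hom g3 g2 := pb_pair P (fmap T m · gd2) (gc1 · gc2) m1_compat.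
Definition m2 : hom g3 g2 :=
  pb_pair P (mu T (g1 A) · fmap T gd1 · gd2) (m · gc2) m2_compat.

End Nerve.

Record TCategory := {
  tc_graph :> PTGraph;
  tc_m : hom (g2 tc_graph) (g1 tc_graph);
  tc_d0m : gd0 tc_graph · tc_m
         = mu T (g0 tc_graph) · fmap T (gd0 tc_graph) · gd1 tc_graph;
  tc_c0m : gc0 tc_graph · tc_m = gc0 tc_graph · gc1 tc_graph;
  tc_mi1 : tc_m · i1 tc_graph = idm (g1 tc_graph);
  tc_mi2 : tc_m · i2 tc_graph = idm (g1 tc_graph);
  tc_mm : tc_m · m1 tc_c0m = tc_m · m2 tc_d0m }.

Lemma f2_compat (A B : PTGraph) (f : TGraphMor A B) :
  fmap T (gc0 B) · (fmap T (f1 f) · gd1 A) = gd0 B · (f1 f · gc1 A).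
Proof.
by rewrite !compA -fmapM f_c0 fmapM f_d0 -!compA g2_comm.
Qed.

Definition f2 (A B : PTGraph) (f : TGraphMor A B) : hom (g2 A) (g2 B) :=
  pb_pair P (fmap T (f1 f) · gd1 A) (f1 f · gc1 A) (f2_compat f).

Record TFunctor (A B : TCategory) := {
  tf_mor :> PTGraphMor A B;
  tf_m : f1 tf_mor · tc_m A = tc_m B · f2 tf_mor }.

Lemma TGraphMor_ext (A B : TGraph) (f g : TGraphMor A B) :
  f0 f = f0 g -> f1 f = f1 g -> f = g.
Proof.
case: f g => [u0 u1 ud uc] [v0 v1 vd vc] /= e0 e1.
subst v0 v1.
by rewrite (proof_irrelevance _ ud vd) (proof_irrelevance _ uc vc).
Qed.

Lemma TFunctor_ext (A B : TCategory) (f g : TFunctor A B) :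
  f0 f = f0 g -> f1 f = f1 g -> f = g.
Proof.
move=> e0 e1; have e := TGraphMor_ext e0 e1.
case: f g e {e0 e1} => [[f fi] fm] [[g gi] gm] /= e; subst g.
have ei := proof_irrelevance _ fi gi; subst gi.
by rewrite (proof_irrelevance _ fm gm).
Qed.

Definition TGraph_id (A : TGraph) : TGraphMor A A.
Proof.
exists (idm (g0 A)) (idm (g1 A)).
- by rewrite compm1 fmap1 comp1m.
- by rewrite compm1 comp1m.
Defined.

Definition TGraph_comp (A B D : TGraph) (g : TGraphMor B D) (f : TGraphMor A B) :
  TGraphMor A D.
Proof.
exists (f0 g · f0 f) (f1 g · f1 f).
- by rewrite compA f_d0 -compA f_d0 compA fmapM.
- by rewrite compA f_c0 -compA f_c0 compA.
Defined.

Lemma f2_id (A : PTGraph) : f2 (TGraph_id A) = idm (g2 A).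
Proof. by apply: pb_ext; rewrite ?pb1_pair ?pb2_pair compm1 /= ?fmap1 comp1m. Qed.

Lemma f2_comp (A B D : PTGraph) (g : TGraphMor B D) (f : TGraphMor A B) :
  f2 (TGraph_comp g f) = f2 g · f2 f.
Proof.
apply: pb_ext.
- by rewrite pb1_pair compA pb1_pair -compA pb1_pair /= fmapM compA.
- by rewrite pb2_pair compA pb2_pair -compA pb2_pair /= compA.
Qed.

Definition TFunctor_id (A : TCategory) : TFunctor A A.
Proof.
unshelve refine {| tf_mor := {| ptm_mor := TGraph_id A |} |}.
- by rewrite /= comp1m compm1.
- by rewrite /= f2_id comp1m compm1.
Defined.

Definition TFunctor_comp (A B D : TCategory)
  (g : TFunctor B D) (f : TFunctor A B) : TFunctor A D.
Proof.
unshelve refine {| tf_mor := {| ptm_mor := TGraph_comp g f |} |}.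
- by rewrite /= -compA ptm_i compA ptm_i -compA.
- by rewrite /= f2_comp -compA tf_m compA tf_m -compA.
Defined.

Definition CatT : Category.
Proof.
exists TCategory TFunctor TFunctor_id TFunctor_comp.
- by move=> A B f; apply: TFunctor_ext; rewrite /= comp1m.
- by move=> A B f; apply: TFunctor_ext; rewrite /= compm1.
- by move=> A B D E h g f; apply: TFunctor_ext; rewrite /= compA.
Defined.

(** The pullback is taken in [C], not in [CatT]. *)
Definition perfect (A B : CatT) (f : hom A B) : Prop :=
  let F : TFunctor A B := f in
  is_pullback (fmap T (f0 F)) (gd0 B) (gd0 A) (f1 F).

End TCategories.

Arguments CatT {C} P T.
Arguments perfect {C P T} A B f.

(* Main.v *)
Require Import Defs.
From Corelib Require Import ssreflect.

Set Implicit Arguments.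
Unset Strict Implicit.
Unset Printing Implicit Defensive.

Local Open Scope cat_scope.

(** Let [f : A -> D] and [g : B -> D] be T-functors.  On objects their pullback
    is the pullback [L_0] of [f_0] and [g_0], with projections [p_0], [q_0].
    Since [T] need not preserve pullbacks, the pullback of [f_1] and [g_1] has
    no domain map into [T L_0]: it only maps to the pullback of [T f_0] and
    [T g_0], which also receives the comparison map from [T L_0].  The object
    [L_1] of arrows is therefore the pullback of these two maps, so that a
    morphism [X -> L_1] is a triple [(t, a, b)] of morphisms to [T L_0], [A_1],
    [B_1] with [f_1 a = g_1 b], [d_0 a = T p_0 t] and [d_0 b = T q_0 t]
    ([arr_pair], [arr_ext]).  The codomain map is forced by the universal
    property of [L_0].

    Units and multiplication are the triples whose first component is the one
    that the axioms for [d_0 i] and [d_0 m] prescribe and whose other components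
    come from [A] and [B].  An equation between morphisms into [L_1] is checked on
    the three components.  On [T L_0] it reduces to a monad law.  On [A_1]
    and [B_1] it reduces to the same axiom in [A] or [B], because a graph
    morphism which preserves units and multiplication commutes with [i_1], [i_2],
    [m_1], [m_2] ([f2_i1], [f2_i2], [f2_m1], [f2_m2]).  The universal property in
    Cat(T) is verified in the same way ([limit_is_pullback]).

    If [f] is perfect, then in a triple [(t, a, b)] the component [a] is
    determined by [T p_0 t] and [g_1 b], so [L_1] is the pullback of [T q_0] and
    [d_0^B]: the projection [q] is perfect ([limit_perfect]).  An arbitrary
    pullback square differs from this one by an isomorphism, and perfectness is
    invariant under precomposition with isomorphisms ([perfect_comp_iso]). *)

(** * Pullbacks up to isomorphism *)

Lemma is_pullback_ext (C : Category) (a b c p : C) (f : hom a c) (g : hom b c)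
    (p1 : hom p a) (p2 : hom p b) (x : C) (h k : hom x p) :
  is_pullback f g p1 p2 -> p1 · h = p1 · k -> p2 · h = p2 · k -> h = k.
Proof.
case=> e U e1 e2.
have E : f · (p1 · k) = g · (p2 · k) by rewrite !compA e.
by case: (U _ _ _ E) => l [_ Ul]; rewrite -(Ul h) // -(Ul k).
Qed.

Lemma is_pullback_iso (C : Category) (a b c p q : C)
    (f : hom a c) (g : hom b c) (p1 : hom p a) (p2 : hom p b)
    (q1 : hom q a) (q2 : hom q b) :
  is_pullback f g p1 p2 -> is_pullback f g q1 q2 ->
  exists (u : hom p q) (v : hom q p),
    q2 · u = p2 /\ u · v = idm q /\ v · u = idm p.
Proof.
move=> Hp Hq.
case: (proj2 Hq _ _ _ (proj1 Hp)) => u [[u1 u2] _].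
case: (proj2 Hp _ _ _ (proj1 Hq)) => v [[v1 v2] _].
exists u, v; split=> //; split.
- by apply: (is_pullback_ext Hq); rewrite compA ?u1 ?u2 ?v1 ?v2 compm1.
- by apply: (is_pullback_ext Hp); rewrite compA ?v1 ?v2 ?u1 ?u2 compm1.
Qed.

(** * Naturality of the structure maps of the nerve *)

Section NerveNaturality.
Variables (C : Category) (P : pullback_choice C) (T : Monad C).

Lemma gd1_f2 (A B : PTGraph T) (f : TGraphMor A B) :
  gd1 P B · f2 P f = fmap T (f1 f) · gd1 P A.
Proof. exact: pb1_pair. Qed.

Lemma gc1_f2 (A B : PTGraph T) (f : TGraphMor A B) :
  gc1 P B · f2 P f = f1 f · gc1 P A.
Proof. exact: pb2_pair. Qed.

Lemma f2_i1 (A B : PTGraph T) (f : PTGraphMor A B) :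
  f2 P f · i1 P A = i1 P B · f1 f.
Proof.
apply: pb_ext; rewrite !compA.
- by rewrite !pb1_pair -compA pb1_pair compA -fmapM ptm_i fmapM -!compA f_d0.
- by rewrite !pb2_pair -compA pb2_pair compm1 comp1m.
Qed.

Lemma f2_i2 (A B : PTGraph T) (f : PTGraphMor A B) :
  f2 P f · i2 P A = i2 P B · f1 f.
Proof.
apply: pb_ext; rewrite !compA.
- by rewrite !pb1_pair -compA pb1_pair eta_nat.
- by rewrite !pb2_pair -compA pb2_pair compA ptm_i -!compA f_c0.
Qed.

Lemma f3_compat (A B : PTGraph T) (f : TGraphMor A B) :
  fmap T (gc1 P B) · (fmap T (f2 P f) · gd2 P A) = gd1 P B · (f2 P f · gc2 P A).
Proof. by rewrite !compA -fmapM gc1_f2 gd1_f2 fmapM -!compA g3_comm. Qed.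

Definition f3 (A B : PTGraph T) (f : TGraphMor A B) : hom (g3 P A) (g3 P B) :=
  pb_pair P (fmap T (f2 P f) · gd2 P A) (f2 P f · gc2 P A) (f3_compat f).

(** The multiplications are explicit here because the source will be a graph
    that is not yet known to be a T-category. *)
Section Multiplication.
Variables (A B : PTGraph T) (f : TGraphMor A B).
Variables (mA : hom (g2 P A) (g1 A)) (mB : hom (g2 P B) (g1 B)).
Hypothesis f_m : f1 f · mA = mB · f2 P f.

Lemma f2_m1 (cA : gc0 A · mA = gc0 A · gc1 P A)
    (cB : gc0 B · mB = gc0 B · gc1 P B) :
  f2 P f · m1 cA = m1 cB · f3 f.
Proof.
apply: pb_ext; rewrite !compA.
- by rewrite !pb1_pair -!compA !pb1_pair !compA -!fmapM f_m.
- by rewrite !pb2_pair -!compA !pb2_pair !compA [in RHS]gc1_f2.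
Qed.

Lemma f2_m2
    (dA : gd0 A · mA = mu T (g0 A) · fmap T (gd0 A) · gd1 P A)
    (dB : gd0 B · mB = mu T (g0 B) · fmap T (gd0 B) · gd1 P B) :
  f2 P f · m2 dA = m2 dB · f3 f.
Proof.
apply: pb_ext; rewrite !compA.
- rewrite !pb1_pair -!compA !pb1_pair !compA mu_nat.
  by rewrite -!(compA (mu T _)) -!fmapM gd1_f2.
- by rewrite !pb2_pair -!compA !pb2_pair !compA f_m.
Qed.

End Multiplication.
End NerveNaturality.

(** * The pullback of two T-functors *)

Section Limit.
Variables (C : Category) (P : pullback_choice C) (T : Monad C).
Variables (A B D : TCategory P T) (f : TFunctor A D) (g : TFunctor B D).

Definition ob_pb : C := pb P (f0 f) (f0 g).
Definition ob_p : hom ob_pb (g0 A) := pb1 P (f0 f) (f0 g).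
Definition ob_q : hom ob_pb (g0 B) := pb2 P (f0 f) (f0 g).

Lemma ob_comm : f0 f · ob_p = f0 g · ob_q.
Proof. exact: pb_comm. Qed.

Lemma dom_cmp_compat : fmap T (f0 f) · fmap T ob_p = fmap T (f0 g) · fmap T ob_q.
Proof. by rewrite -!fmapM ob_comm. Qed.

Definition dom_cmp : hom (T ob_pb) (pb P (fmap T (f0 f)) (fmap T (f0 g))) :=
  pb_pair P (fmap T ob_p) (fmap T ob_q) dom_cmp_compat.

Lemma dom_arr_compat :
  fmap T (f0 f) · (gd0 A · pb1 P (f1 f) (f1 g))
  = fmap T (f0 g) · (gd0 B · pb2 P (f1 f) (f1 g)).
Proof. by rewrite !compA -!f_d0 -!compA pb_comm. Qed.

Definition dom_arr :
    hom (pb P (f1 f) (f1 g)) (pb P (fmap T (f0 f)) (fmap T (f0 g))) :=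
  pb_pair P _ _ dom_arr_compat.

(** Were [dom_cmp] invertible, this would be the pullback of [f1 f] and
    [f1 g]. *)
Definition arr_pb : C := pb P dom_cmp dom_arr.
Definition arr_d : hom arr_pb (T ob_pb) := pb1 P dom_cmp dom_arr.
(** The two projections are locked because rewriting with associativity would
    otherwise see through them: they are themselves composites. *)
Definition arr_p : hom arr_pb (g1 A) :=
  locked (pb1 P (f1 f) (f1 g) · pb2 P dom_cmp dom_arr).
Definition arr_q : hom arr_pb (g1 B) :=
  locked (pb2 P (f1 f) (f1 g) · pb2 P dom_cmp dom_arr).

Lemma arr_comm : f1 f · arr_p = f1 g · arr_q.
Proof. by rewrite /arr_p /arr_q -!lock !compA pb_comm. Qed.

Lemma arr_dp : gd0 A · arr_p = fmap T ob_p · arr_d.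
Proof.
have := f_equal (comp (pb1 P _ _)) (pb_comm P dom_cmp dom_arr).
by rewrite /arr_p /arr_d -!lock !compA !pb1_pair.
Qed.

Lemma arr_dq : gd0 B · arr_q = fmap T ob_q · arr_d.
Proof.
have := f_equal (comp (pb2 P _ _)) (pb_comm P dom_cmp dom_arr).
by rewrite /arr_q /arr_d -!lock !compA !pb2_pair.
Qed.

Lemma arr_ext (X : C) (h k : hom X arr_pb) :
  arr_d · h = arr_d · k -> arr_p · h = arr_p · k -> arr_q · h = arr_q · k ->
  h = k.
Proof.
rewrite /arr_p /arr_q -!lock -!compA => ed ep eq.
by apply: pb_ext => //; apply: pb_ext.
Qed.

Section ArrPair.
Variables (X : C) (t : hom X (T ob_pb)) (a : hom X (g1 A)) (b : hom X (g1 B)).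
Hypotheses (eab : f1 f · a = f1 g · b)
  (ea : gd0 A · a = fmap T ob_p · t) (eb : gd0 B · b = fmap T ob_q · t).

Lemma arr_pair_compat : dom_cmp · t = dom_arr · pb_pair P a b eab.
Proof.
apply: pb_ext; rewrite !compA.
- by rewrite !pb1_pair -compA pb1_pair ea.
- by rewrite !pb2_pair -compA pb2_pair eb.
Qed.

Definition arr_pair : hom X arr_pb := pb_pair P t _ arr_pair_compat.

Lemma arr_d_pair : arr_d · arr_pair = t.
Proof. exact: pb1_pair. Qed.

Lemma arr_p_pair : arr_p · arr_pair = a.
Proof. by rewrite /arr_p -lock -compA pb2_pair pb1_pair. Qed.

Lemma arr_q_pair : arr_q · arr_pair = b.
Proof. by rewrite /arr_q -lock -compA pb2_pair pb2_pair. Qed.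

End ArrPair.


Lemma arr_c_compat : f0 f · (gc0 A · arr_p) = f0 g · (gc0 B · arr_q).
Proof. by rewrite !compA -!f_c0 -!compA arr_comm. Qed.

Definition arr_c : hom arr_pb ob_pb := pb_pair P _ _ arr_c_compat.

Lemma ob_p_c : ob_p · arr_c = gc0 A · arr_p.
Proof. exact: pb1_pair. Qed.

Lemma ob_q_c : ob_q · arr_c = gc0 B · arr_q.
Proof. exact: pb2_pair. Qed.

Definition limit_graph : TGraph T := {| gd0 := arr_d; gc0 := arr_c |}.

Lemma arr_i_comm : f1 f · (pt_i A · ob_p) = f1 g · (pt_i B · ob_q).
Proof. by rewrite !compA !ptm_i -!compA ob_comm. Qed.

Lemma arr_i_dp : gd0 A · (pt_i A · ob_p) = fmap T ob_p · eta T ob_pb.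
Proof. by rewrite compA pt_d0i eta_nat. Qed.

Lemma arr_i_dq : gd0 B · (pt_i B · ob_q) = fmap T ob_q · eta T ob_pb.
Proof. by rewrite compA pt_d0i eta_nat. Qed.

Definition arr_i : hom ob_pb arr_pb := arr_pair arr_i_comm arr_i_dp arr_i_dq.

Definition limit_pgraph : PTGraph T.
Proof.
exists limit_graph arr_i.
- exact: arr_d_pair.
- apply: pb_ext; rewrite /= compA compm1.
  + by rewrite pb1_pair -compA arr_p_pair compA pt_c0i comp1m.
  + by rewrite pb2_pair -compA arr_q_pair compA pt_c0i comp1m.
Defined.

Definition graph_p : PTGraphMor limit_pgraph A.
Proof.
unshelve refine (@Build_PTGraphMor _ _ limit_pgraph A
  (@Build_TGraphMor _ _ limit_graph A ob_p arr_p _ _) _).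
- exact: arr_dp.
- by rewrite ob_p_c.
- exact: arr_p_pair.
Defined.

Definition graph_q : PTGraphMor limit_pgraph B.
Proof.
unshelve refine (@Build_PTGraphMor _ _ limit_pgraph B
  (@Build_TGraphMor _ _ limit_graph B ob_q arr_q _ _) _).
- exact: arr_dq.
- by rewrite ob_q_c.
- exact: arr_q_pair.
Defined.

Lemma graph_comm : TGraph_comp f graph_p = TGraph_comp g graph_q.
Proof. by apply: TGraphMor_ext; [exact: ob_comm | exact: arr_comm]. Qed.

Lemma arr_m_comm :
  f1 f · (tc_m A · f2 P graph_p) = f1 g · (tc_m B · f2 P graph_q).
Proof. by rewrite !compA !tf_m -!compA -!f2_comp graph_comm. Qed.

(** Both multiplication squares over [T L_0] use only that the projection is a
    graph morphism, so they are instances of one fact. *)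
Lemma d0_m_f2 (E : PTGraph T) (F : TCategory P T) (h : TGraphMor E F) :
  gd0 F · (tc_m F · f2 P h)
  = fmap T (f0 h) · (mu T (g0 E) · fmap T (gd0 E) · gd1 P E).
Proof.
rewrite compA tc_d0m -compA gd1_f2 !compA mu_nat.
by rewrite -!(compA (mu T _)) -!fmapM f_d0.
Qed.

Definition arr_m : hom (g2 P limit_pgraph) arr_pb :=
  arr_pair arr_m_comm (d0_m_f2 graph_p) (d0_m_f2 graph_q).

Lemma arr_p_m : arr_p · arr_m = tc_m A · f2 P graph_p.
Proof. exact: arr_p_pair. Qed.

Lemma arr_q_m : arr_q · arr_m = tc_m B · f2 P graph_q.
Proof. exact: arr_q_pair. Qed.

Lemma arr_d0m :
  arr_d · arr_m = mu T ob_pb · fmap T arr_d · gd1 P limit_pgraph.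
Proof. exact: arr_d_pair. Qed.

Lemma arr_c0m : arr_c · arr_m = arr_c · gc1 P limit_pgraph.
Proof.
apply: pb_ext; rewrite !compA.
- by rewrite ob_p_c -!compA arr_p_m compA tc_c0m -compA gc1_f2.
- by rewrite ob_q_c -!compA arr_q_m compA tc_c0m -compA gc1_f2.
Qed.

Lemma arr_mi1 : arr_m · i1 P limit_pgraph = idm arr_pb.
Proof.
apply: arr_ext; rewrite compA compm1.
- rewrite arr_d0m -compA pb1_pair /= -!compA [fmap T arr_d · _]compA -fmapM.
  by rewrite arr_d_pair compA mu_etar comp1m.
- by rewrite arr_p_m -compA f2_i1 compA tc_mi1 comp1m.
- by rewrite arr_q_m -compA f2_i1 compA tc_mi1 comp1m.
Qed.

Lemma arr_mi2 : arr_m · i2 P limit_pgraph = idm arr_pb.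
Proof.
apply: arr_ext; rewrite compA compm1.
- by rewrite arr_d0m -compA pb1_pair -compA eta_nat compA mu_etal comp1m.
- by rewrite arr_p_m -compA f2_i2 compA tc_mi2 comp1m.
- by rewrite arr_q_m -compA f2_i2 compA tc_mi2 comp1m.
Qed.

Lemma arr_mm :
  arr_m · @m1 _ P _ limit_pgraph _ arr_c0m = arr_m · @m2 _ P _ limit_pgraph _ arr_d0m.
Proof.
apply: arr_ext; rewrite !compA.
- rewrite arr_d0m -!compA !pb1_pair.
  rewrite [fmap T arr_d · (fmap T _ · _)]compA -fmapM arr_d0m !fmapM.
  (* Associativity of the monad on the left, naturality of mu on the right. *)
  rewrite !compA -mu_assoc.
  by rewrite -(compA (mu T ob_pb) (fmap T arr_d)) mu_nat !compA.
- by rewrite arr_p_m -!compA (f2_m1 (f := graph_p) arr_p_m _ (tc_c0m A))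
    (f2_m2 (f := graph_p) arr_p_m _ (tc_d0m A)) !compA tc_mm.
- by rewrite arr_q_m -!compA (f2_m1 (f := graph_q) arr_q_m _ (tc_c0m B))
    (f2_m2 (f := graph_q) arr_q_m _ (tc_d0m B)) !compA tc_mm.
Qed.

Definition limit : CatT P T :=
  @Build_TCategory _ P T limit_pgraph arr_m arr_d0m arr_c0m arr_mi1 arr_mi2 arr_mm.

Definition limit_p : TFunctor limit A :=
  @Build_TFunctor _ _ _ limit A graph_p arr_p_m.

Definition limit_q : TFunctor limit B :=
  @Build_TFunctor _ _ _ limit B graph_q arr_q_m.

(** * The universal property *)

Section Mediator.
Variables (X : TCategory P T) (h : TFunctor X A) (k : TFunctor X B).
Hypothesis e : TFunctor_comp f h = TFunctor_comp g k.

Lemma med_comm0 : f0 f · f0 h = f0 g · f0 k.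
Proof. exact: (f_equal (fun u : TFunctor X D => f0 u) e). Qed.

Lemma med_comm1 : f1 f · f1 h = f1 g · f1 k.
Proof. exact: (f_equal (fun u : TFunctor X D => f1 u) e). Qed.

Definition med0 : hom (g0 X) ob_pb := pb_pair P _ _ med_comm0.

Lemma med0_p : ob_p · med0 = f0 h.
Proof. exact: pb1_pair. Qed.

Lemma med0_q : ob_q · med0 = f0 k.
Proof. exact: pb2_pair. Qed.

Lemma med_dp : gd0 A · f1 h = fmap T ob_p · (fmap T med0 · gd0 X).
Proof. by rewrite compA -fmapM med0_p f_d0. Qed.

Lemma med_dq : gd0 B · f1 k = fmap T ob_q · (fmap T med0 · gd0 X).
Proof. by rewrite compA -fmapM med0_q f_d0. Qed.

Definition med1 : hom (g1 X) arr_pb := arr_pair med_comm1 med_dp med_dq.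

Lemma med1_p : arr_p · med1 = f1 h.
Proof. exact: arr_p_pair. Qed.

Lemma med1_q : arr_q · med1 = f1 k.
Proof. exact: arr_q_pair. Qed.

Lemma med1_d : arr_d · med1 = fmap T med0 · gd0 X.
Proof. exact: arr_d_pair. Qed.

Definition med_graph : TGraphMor X limit_graph.
Proof.
exists med0 med1; first exact: med1_d.
apply: pb_ext; rewrite !compA.
- by rewrite ob_p_c med0_p -compA med1_p f_c0.
- by rewrite ob_q_c med0_q -compA med1_q f_c0.
Defined.

Lemma med_graph_p : TGraph_comp graph_p med_graph = h.
Proof. by apply: TGraphMor_ext; [exact: med0_p | exact: med1_p]. Qed.

Lemma med_graph_q : TGraph_comp graph_q med_graph = k.
Proof. by apply: TGraphMor_ext; [exact: med0_q | exact: med1_q]. Qed.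

Lemma med_i : med1 · pt_i X = arr_i · med0.
Proof.
apply: arr_ext; rewrite !compA.
- by rewrite med1_d arr_d_pair -compA pt_d0i eta_nat.
- by rewrite med1_p arr_p_pair -compA med0_p ptm_i.
- by rewrite med1_q arr_q_pair -compA med0_q ptm_i.
Qed.

Lemma med_m : med1 · tc_m X = arr_m · @f2 _ P _ X limit_pgraph med_graph.
Proof.
apply: arr_ext; rewrite !compA.
- rewrite med1_d -compA tc_d0m arr_d0m -[in RHS]compA gd1_f2 !compA mu_nat.
  by rewrite -!(compA (mu T _)) -!fmapM med1_d.
- by rewrite med1_p arr_p_m -compA -(@f2_comp _ _ _ X limit_pgraph A) med_graph_p tf_m.
- by rewrite med1_q arr_q_m -compA -(@f2_comp _ _ _ X limit_pgraph B) med_graph_q tf_m.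
Qed.

Definition med : TFunctor X limit :=
  @Build_TFunctor _ _ _ X limit (@Build_PTGraphMor _ _ X limit_pgraph med_graph med_i) med_m.

End Mediator.

Lemma limit_is_pullback :
  @is_pullback (CatT P T) A B D limit f g limit_p limit_q.
Proof.
split; first by apply: TFunctor_ext; [exact: ob_comm | exact: arr_comm].
move=> X h k e; exists (med e); split.
  split; apply: TFunctor_ext;
    [exact: med0_p | exact: med1_p | exact: med0_q | exact: med1_q].
move=> l [lp lq].
have E0 : med0 e = f0 l.
  by apply: pb_ext; rewrite ?pb1_pair ?pb2_pair; [rewrite -lp | rewrite -lq].
apply: TFunctor_ext => //; apply: arr_ext.
- by rewrite [LHS]med1_d E0; exact: (eq_sym (f_d0 l)).
- by rewrite [LHS]med1_p -lp.
- by rewrite [LHS]med1_q -lq.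
Qed.

(** * Perfect T-functors *)

(** Given [t] and [b], the missing component [a] of a triple is the unique lift
    through the pullback square of [f]. *)
Lemma limit_perfect :
  @perfect C P T A D f -> @perfect C P T limit B limit_q.
Proof.
move=> Hf; split; first by rewrite /= arr_dq.
move=> X t b /= etb.
have E : fmap T (f0 f) · (fmap T ob_p · t) = gd0 D · (f1 g · b).
  by rewrite !compA dom_cmp_compat f_d0 -!compA etb.
case: (proj2 Hf _ _ _ E) => a [[ea eab] _].
exists (arr_pair eab ea (eq_sym etb)); split.
  by split; [exact: arr_d_pair | exact: arr_q_pair].
move=> l [ld lq]; apply: arr_ext.
- by rewrite arr_d_pair -ld.
- apply: (is_pullback_ext Hf).
  + by rewrite arr_p_pair ea -ld !compA arr_dp.
  + by rewrite arr_p_pair eab -lq !compA arr_comm.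
- by rewrite arr_q_pair -lq.
Qed.

End Limit.

Lemma perfect_comp_iso (C : Category) (P : pullback_choice C) (T : Monad C)
    (A B D : CatT P T) (u : hom A B) (v : hom B A) (f : hom B D) :
  u · v = idm B -> v · u = idm A -> perfect _ _ f -> perfect _ _ (f · u).
Proof.
move=> euv evu Hf.
have uv1 : f1 u · f1 v = idm (g1 B).
  exact: (f_equal (fun w : TFunctor B B => f1 w) euv).
have vu1 : f1 v · f1 u = idm (g1 A).
  exact: (f_equal (fun w : TFunctor A A => f1 w) evu).
have vu0 : f0 v · f0 u = idm (g0 A).
  exact: (f_equal (fun w : TFunctor A A => f0 w) evu).
split; first exact: (eq_sym (f_d0 (TFunctor_comp f u))).
move=> X t b; rewrite /= fmapM -compA => e.
case: (proj2 Hf _ _ _ e) => a [[ea eb] _].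
exists (f1 v · a); split.
  split; last by rewrite -compA [f1 u · _]compA uv1 comp1m.
  by rewrite compA f_d0 -compA ea compA -fmapM vu0 fmap1 comp1m.
move=> l [lt lb].
have -> : a = f1 u · l.
  apply: (is_pullback_ext Hf); first by rewrite ea -lt !compA f_d0.
  by rewrite eb -lb compA.
by rewrite compA vu1 comp1m.
Qed.

Theorem proposition6p2 (C : Category) (P : pullback_choice C) (T : Monad C) :
  has_pullbacks (CatT P T) /\ pullback_stable (@perfect C P T).
Proof.
split=> [A B D f g | A B D Q f g p q HQ Hf].
  exists (limit f g), (limit_p f g), (limit_q f g).
  exact: limit_is_pullback.
case: (is_pullback_iso HQ (limit_is_pullback f g)) => u [v [<- [uv vu]]].
exact: (perfect_comp_iso uv vu (limit_perfect g Hf)).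
Qed.
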